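(* Let $(D,\prec,\succ)$ be a dendriform algebra, let $(D',\prec',\succ';\prec_l,\succ_l,\prec_r,\succ_r)$ be an action of $D$, and let $T:D'\to D$ be a homomorphic relative averaging operator on $(D,\prec,\succ)$ with respect to this action. Then $(D',\prec_\perp,\succ_\perp,\prec_\vdash^T,\prec_\dashv^T,\succ_\vdash^T,\succ_\dashv^T)$ is a six-dendriform algebra, where for all $u,v\in D'$ $$u\prec_\perp v=u\prec' v,\quad u\succ_\perp v=u\succ' v,\quad u\prec_\vdash^T v=Tu\prec_l v,\quad u\prec_\dashv^T v=u\prec_r Tv,\quad u\succ_\vdash^T v=Tu\succ_l v,\quad u\succ_\dashv^T v=u\succ_r Tv.$$
   Context: Throughout, $\mathbb{K}$ is a field of characteristic zero; all vector spaces and (multi)linear maps are over $\mathbb{K}$, and all binary operations are bilinear. A dendriform algebra is a vector space $D$ with binary operations $\prec,\succ:D\otimes D\to D$ such that for all $x,y,z\in D$: $(x\prec y)\prec z=x\prec(y\prec z+y\succ z)$, $(x\succ y)\prec z=x\succ(y\prec z)$, $x\succ(y\succ z)=(x\prec y+x\succ y)\succ z$. A dendriform homomorphism is a linear map preserving both operations. A representation of $(D,\prec,\succ)$ is a vector space $V$ with bilinear maps $\prec_l,\succ_l:D\otimes V\to V$ and $\prec_r,\succ_r:V\otimes D\to V$ such that for all $x,y,z\in D$, $u\in V$: $(x\prec y)\prec_l u=x\prec_l(y\prec_l u+y\succ_l u)$, $(x\succ y)\prec_l u=x\succ_l(y\prec_l u)$, $x\succ_l(y\succ_l u)=(x\prec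 y+x\succ y)\succ_l u$, $(x\prec_l u)\prec_r z=x\prec_l(u\prec_r z+u\succ_r z)$, $(x\succ_l u)\prec_r z=x\succ_l(u\prec_r z)$, $x\succ_l(u\succ_r z)=(x\prec_l u+x\succ_l u)\succ_r z$, $(u\prec_r y)\prec_r z=u\prec_r(y\prec z+y\succ z)$, $(u\succ_r y)\prec_r z=u\succ_r(y\prec z)$, $u\succ_r(y\succ z)=(u\prec_r y+u\succ_r y)\succ_r z$. Let $(D,\prec,\succ)$ and $(D',\prec',\succ')$ be dendriform algebras. An action of $D$, written $(D',\prec',\succ';\prec_l,\succ_l,\prec_r,\succ_r)$, consists of bilinear maps $\prec_l,\succ_l:D\otimes D'\to D'$ and $\prec_r,\succ_r:D'\otimes D\to D'$ such that $(D';\prec_l,\succ_l,\prec_r,\succ_r)$ is a representation of $D$ and for all $x,y,z\in D$, $u,v,w\in D'$: $(x\prec_l v)\prec' w=x\prec_l(v\prec' w+v\succ' w)$, $(x\succ_l v)\prec' w=x\succ_l(v\prec' w)$, $x\succ_l(v\succ' w)=(x\prec_l v+x\succ_l v)\succ' w$, $(u\prec_r y)\prec' w=u\prec'(y\prec_l w+y\succ_l w)$, $(u\succ_r y)\prec' w=u\succ'(y\prec_l w)$, $u\succ'(y\succ_l w)=(u\prec_r y+u\succ_r y)\succ' w$, $(u\prec' v)\prec_r z=u\prec'(v\prec_r z+v\succ_r z)$, $(u\succ' v)\prec_r z=u\succ'(v\prec_r z)$, $u\succ'(v\succ_r z)=(u\prec' v+u\succ' v)\succ_r z$. A relative averaging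 operator on $D$ with respect to a representation $(V;\prec_l,\succ_l,\prec_r,\succ_r)$ is a linear map $T:V\to D$ with $Tu\prec Tv=T(Tu\prec_l v)=T(u\prec_r Tv)$ and $Tu\succ Tv=T(Tu\succ_l v)=T(u\succ_r Tv)$ for all $u,v\in V$. A homomorphic relative averaging operator on $D$ with respect to an action $(D',\prec',\succ';\prec_l,\succ_l,\prec_r,\succ_r)$ is a linear map $T:D'\to D$ that is both a relative averaging operator (with respect to the underlying representation $D'$) and a dendriform homomorphism from $(D',\prec',\succ')$ to $(D,\prec,\succ)$. A quadri-dendriform algebra is a vector space $\mathcal{D}$ with four binary operations $\prec_\vdash,\prec_\dashv,\succ_\vdash,\succ_\dashv$ such that for all $x,y,z\in\mathcal{D}$: (1) $(x\prec_\vdash y)\prec_\vdash z=(x\prec_\dashv y)\prec_\vdash z=x\prec_\vdash(y\prec_\vdash z+y\succ_\vdash z)$; (2) $(x\succ_\vdash y)\prec_\vdash z=(x\succ_\dashv y)\prec_\vdash z=x\succ_\vdash(y\prec_\vdash z)$; (3) $x\succ_\vdash(y\succ_\vdash z)=(x\prec_\vdash y+x\succ_\vdash y)\succ_\vdash z=(x\prec_\dashv y+x\succ_\dashv y)\succ_\vdash z=(x\prec_\vdash y+x\succ_\dashv y)\succ_\vdash z=(x\prec_\dashv y+x\succ_\vdash y)\succ_\vdash z$; (4) $(x\prec_\vdash y)\prec_\dashv z=x\prec_\vdash(y\prec_\dashv z+y\succ_\dashv z)$; (5) $(x\succ_\vdash y)\prec_\dashv z=x\succ_\vdash(y\prec_\dashv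 z)$; (6) $x\succ_\vdash(y\succ_\dashv z)=(x\prec_\vdash y+x\succ_\vdash y)\succ_\dashv z$; (7) $(x\prec_\dashv y)\prec_\dashv z=x\prec_\dashv(y\prec_\vdash z+y\succ_\vdash z)=x\prec_\dashv(y\prec_\dashv z+y\succ_\dashv z)=x\prec_\dashv(y\prec_\vdash z+y\succ_\dashv z)=x\prec_\dashv(y\prec_\dashv z+y\succ_\vdash z)$; (8) $(x\succ_\dashv y)\prec_\dashv z=x\succ_\dashv(y\prec_\vdash z)=x\succ_\dashv(y\prec_\dashv z)$; (9) $x\succ_\dashv(y\succ_\vdash z)=x\succ_\dashv(y\succ_\dashv z)=(x\prec_\dashv y+x\succ_\dashv y)\succ_\dashv z$. A six-dendriform algebra is a vector space $\mathcal{D}$ with six binary operations such that $(\mathcal{D},\prec_\perp,\succ_\perp)$ is a dendriform algebra, $(\mathcal{D},\prec_\vdash,\prec_\dashv,\succ_\vdash,\succ_\dashv)$ is a quadri-dendriform algebra, and for all $x,y,z\in\mathcal{D}$: (A) $(x\prec_\vdash y)\prec_\perp z=x\prec_\vdash(y\prec_\perp z+y\succ_\perp z)$; $(x\succ_\vdash y)\prec_\perp z=x\succ_\vdash(y\prec_\perp z)$; $x\succ_\vdash(y\succ_\perp z)=(x\prec_\vdash y+x\succ_\vdash y)\succ_\perp z$; $(x\prec_\dashv y)\prec_\perp z=x\prec_\perp(y\prec_\vdash z+y\succ_\vdash z)$; $(x\succ_\dashv y)\prec_\perp z=x\succ_\perp(y\prec_\vdash z)$; $x\succ_\perp(y\succ_\vdash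 z)=(x\prec_\dashv y+x\succ_\dashv y)\succ_\perp z$; $(x\prec_\perp y)\prec_\dashv z=x\prec_\perp(y\prec_\dashv z+y\succ_\dashv z)$; $(x\succ_\perp y)\prec_\dashv z=x\succ_\perp(y\prec_\dashv z)$; $x\succ_\perp(y\succ_\dashv z)=(x\prec_\perp y+x\succ_\perp y)\succ_\dashv z$; (B) $(x\prec_\perp y)\prec_\vdash z=(x\prec_\vdash y)\prec_\vdash z=(x\prec_\dashv y)\prec_\vdash z$; $(x\succ_\perp y)\prec_\vdash z=(x\succ_\vdash y)\prec_\vdash z=(x\succ_\dashv y)\prec_\vdash z$; $(x\prec_\perp y)\succ_\vdash z=(x\prec_\vdash y)\succ_\vdash z=(x\prec_\dashv y)\succ_\vdash z$; $(x\succ_\perp y)\succ_\vdash z=(x\succ_\vdash y)\succ_\vdash z=(x\succ_\dashv y)\succ_\vdash z$; (C) $x\prec_\dashv(y\prec_\perp z)=x\prec_\dashv(y\prec_\vdash z)=x\prec_\dashv(y\prec_\dashv z)$; $x\succ_\dashv(y\prec_\perp z)=x\succ_\dashv(y\prec_\vdash z)=x\succ_\dashv(y\prec_\dashv z)$; $x\prec_\dashv(y\succ_\perp z)=x\prec_\dashv(y\succ_\vdash z)=x\prec_\dashv(y\succ_\dashv z)$; $x\succ_\dashv(y\succ_\perp z)=x\succ_\dashv(y\succ_\vdash z)=x\succ_\dashv(y\succ_\dashv z)$. *)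

(* Defs.v *)
From mathcomp Require Import all_boot all_order all_algebra.

Set Implicit Arguments.
Unset Strict Implicit.
Unset Printing Implicit Defensive.

Import GRing.Theory.
Local Open Scope ring_scope.

Definition is_bilinear (K : fieldType) (U V W : lmodType K)
    (f : U -> V -> W) : Prop :=
  (forall v, linear (fun u => f u v)) /\ (forall u, linear (f u)).

Section Dendriform.

Context (K : fieldType) (D : lmodType K) (prec succ : D -> D -> D).

Local Notation "x ≺ y" := (prec x y) (at level 40, no associativity).
Local Notation "x ≻ y" := (succ x y) (at level 40, no associativity).

Record is_dendriform : Prop := IsDendriform {
  dendriform_prec_bilinear : is_bilinear prec;
  dendriform_succ_bilinear : is_bilinear succ;
  dendriform_prec_prec : forall x y z, (x ≺ y) ≺ z = x ≺ (y ≺ z + y ≻ z);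
  dendriform_succ_prec : forall x y z, (x ≻ y) ≺ z = x ≻ (y ≺ z);
  dendriform_succ_succ : forall x y z, x ≻ (y ≻ z) = (x ≺ y + x ≻ y) ≻ z
}.

End Dendriform.

Record is_dendriform_hom (K : fieldType) (D D' : lmodType K)
    (prec succ : D -> D -> D) (prec' succ' : D' -> D' -> D')
    (f : D -> D') : Prop := IsDendriformHom {
  dendriform_hom_linear : linear f;
  dendriform_hom_prec : forall x y, f (prec x y) = prec' (f x) (f y);
  dendriform_hom_succ : forall x y, f (succ x y) = succ' (f x) (f y)
}.

Section Representation.

Context (K : fieldType) (D V : lmodType K) (prec succ : D -> D -> D).
Context (precl succl : D -> V -> V) (precr succr : V -> D -> V).

Local Notation "x ≺ y" := (prec x y) (at level 40, no associativity).
Local Notation "x ≻ y" := (succ x y) (at level 40, no associativity).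
Local Notation "x ≺l u" := (precl x u) (at level 40, no associativity).
Local Notation "x ≻l u" := (succl x u) (at level 40, no associativity).
Local Notation "u ≺r x" := (precr u x) (at level 40, no associativity).
Local Notation "u ≻r x" := (succr u x) (at level 40, no associativity).

Record is_representation : Prop := IsRepresentation {
  repr_precl_bilinear : is_bilinear precl;
  repr_succl_bilinear : is_bilinear succl;
  repr_precr_bilinear : is_bilinear precr;
  repr_succr_bilinear : is_bilinear succr;

  repr_ll_prec_prec : forall x y u, (x ≺ y) ≺l u = x ≺l (y ≺l u + y ≻l u);
  repr_ll_succ_prec : forall x y u, (x ≻ y) ≺l u = x ≻l (y ≺l u);
  repr_ll_succ_succ : forall x y u, x ≻l (y ≻l u) = (x ≺ y + x ≻ y) ≻l u;

  repr_lr_prec_prec : forall x u z, (x ≺l u) ≺r z = x ≺l (u ≺r z + u ≻r z);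
  repr_lr_succ_prec : forall x u z, (x ≻l u) ≺r z = x ≻l (u ≺r z);
  repr_lr_succ_succ : forall x u z, x ≻l (u ≻r z) = (x ≺l u + x ≻l u) ≻r z;

  repr_rr_prec_prec : forall u y z, (u ≺r y) ≺r z = u ≺r (y ≺ z + y ≻ z);
  repr_rr_succ_prec : forall u y z, (u ≻r y) ≺r z = u ≻r (y ≺ z);
  repr_rr_succ_succ : forall u y z, u ≻r (y ≻ z) = (u ≺r y + u ≻r y) ≻r z
}.

Record is_relative_averaging_operator (T : V -> D) : Prop :=
    IsRelativeAveragingOperator {
  averaging_linear : linear T;
  averaging_precl : forall u v, T u ≺ T v = T (T u ≺l v);
  averaging_precr : forall u v, T u ≺ T v = T (u ≺r T v);
  averaging_succl : forall u v, T u ≻ T v = T (T u ≻l v);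
  averaging_succr : forall u v, T u ≻ T v = T (u ≻r T v)
}.

End Representation.

Section Action.

Context (K : fieldType) (D D' : lmodType K).
Context (prec succ : D -> D -> D) (prec' succ' : D' -> D' -> D').
Context (precl succl : D -> D' -> D') (precr succr : D' -> D -> D').

Local Notation "u ≺' v" := (prec' u v) (at level 40, no associativity).
Local Notation "u ≻' v" := (succ' u v) (at level 40, no associativity).
Local Notation "x ≺l u" := (precl x u) (at level 40, no associativity).
Local Notation "x ≻l u" := (succl x u) (at level 40, no associativity).
Local Notation "u ≺r x" := (precr u x) (at level 40, no associativity).
Local Notation "u ≻r x" := (succr u x) (at level 40, no associativity).

Record is_action : Prop := IsAction {
  action_representation :
    is_representation prec succ precl succl precr succr;

  action_l_prec_prec : forall x v w,
    (x ≺l v) ≺' w = x ≺l (v ≺' w + v ≻' w);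
  action_l_succ_prec : forall x v w, (x ≻l v) ≺' w = x ≻l (v ≺' w);
  action_l_succ_succ : forall x v w,
    x ≻l (v ≻' w) = (x ≺l v + x ≻l v) ≻' w;

  action_m_prec_prec : forall u y w,
    (u ≺r y) ≺' w = u ≺' (y ≺l w + y ≻l w);
  action_m_succ_prec : forall u y w, (u ≻r y) ≺' w = u ≻' (y ≺l w);
  action_m_succ_succ : forall u y w,
    u ≻' (y ≻l w) = (u ≺r y + u ≻r y) ≻' w;

  action_r_prec_prec : forall u v z,
    (u ≺' v) ≺r z = u ≺' (v ≺r z + v ≻r z);
  action_r_succ_prec : forall u v z, (u ≻' v) ≺r z = u ≻' (v ≺r z);
  action_r_succ_succ : forall u v z,
    u ≻' (v ≻r z) = (u ≺' v + u ≻' v) ≻r z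
}.

Record is_homomorphic_relative_averaging_operator (T : D' -> D) : Prop :=
    IsHomomorphicRelativeAveragingOperator {
  hom_averaging_averaging :
    is_relative_averaging_operator prec succ precl succl precr succr T;
  hom_averaging_hom : is_dendriform_hom prec' succ' prec succ T
}.

End Action.

Section QuadriDendriform.

Context (K : fieldType) (D : lmodType K).
Context (prec_vdash prec_dashv succ_vdash succ_dashv : D -> D -> D).

Local Notation "x ≺⊢ y" := (prec_vdash x y) (at level 40, no associativity).
Local Notation "x ≺⊣ y" := (prec_dashv x y) (at level 40, no associativity).
Local Notation "x ≻⊢ y" := (succ_vdash x y) (at level 40, no associativity).
Local Notation "x ≻⊣ y" := (succ_dashv x y) (at level 40, no associativity).

Record is_quadri_dendriform : Prop := IsQuadriDendriform {
  quadri_prec_vdash_bilinear : is_bilinear prec_vdash;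
  quadri_prec_dashv_bilinear : is_bilinear prec_dashv;
  quadri_succ_vdash_bilinear : is_bilinear succ_vdash;
  quadri_succ_dashv_bilinear : is_bilinear succ_dashv;

  quadri1 : forall x y z,
    (x ≺⊢ y) ≺⊢ z = (x ≺⊣ y) ≺⊢ z
    /\ (x ≺⊣ y) ≺⊢ z = x ≺⊢ (y ≺⊢ z + y ≻⊢ z);
  quadri2 : forall x y z,
    (x ≻⊢ y) ≺⊢ z = (x ≻⊣ y) ≺⊢ z
    /\ (x ≻⊣ y) ≺⊢ z = x ≻⊢ (y ≺⊢ z);
  quadri3 : forall x y z,
    [/\ x ≻⊢ (y ≻⊢ z) = (x ≺⊢ y + x ≻⊢ y) ≻⊢ z,
        (x ≺⊢ y + x ≻⊢ y) ≻⊢ z = (x ≺⊣ y + x ≻⊣ y) ≻⊢ z,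
        (x ≺⊣ y + x ≻⊣ y) ≻⊢ z = (x ≺⊢ y + x ≻⊣ y) ≻⊢ z
      & (x ≺⊢ y + x ≻⊣ y) ≻⊢ z = (x ≺⊣ y + x ≻⊢ y) ≻⊢ z];
  quadri4 : forall x y z, (x ≺⊢ y) ≺⊣ z = x ≺⊢ (y ≺⊣ z + y ≻⊣ z);
  quadri5 : forall x y z, (x ≻⊢ y) ≺⊣ z = x ≻⊢ (y ≺⊣ z);
  quadri6 : forall x y z, x ≻⊢ (y ≻⊣ z) = (x ≺⊢ y + x ≻⊢ y) ≻⊣ z;
  quadri7 : forall x y z,
    [/\ (x ≺⊣ y) ≺⊣ z = x ≺⊣ (y ≺⊢ z + y ≻⊢ z),
        x ≺⊣ (y ≺⊢ z + y ≻⊢ z) = x ≺⊣ (y ≺⊣ z + y ≻⊣ z),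
        x ≺⊣ (y ≺⊣ z + y ≻⊣ z) = x ≺⊣ (y ≺⊢ z + y ≻⊣ z)
      & x ≺⊣ (y ≺⊢ z + y ≻⊣ z) = x ≺⊣ (y ≺⊣ z + y ≻⊢ z)];
  quadri8 : forall x y z,
    (x ≻⊣ y) ≺⊣ z = x ≻⊣ (y ≺⊢ z)
    /\ x ≻⊣ (y ≺⊢ z) = x ≻⊣ (y ≺⊣ z);
  quadri9 : forall x y z,
    x ≻⊣ (y ≻⊢ z) = x ≻⊣ (y ≻⊣ z)
    /\ x ≻⊣ (y ≻⊣ z) = (x ≺⊣ y + x ≻⊣ y) ≻⊣ z
}.

End QuadriDendriform.

Section SixDendriform.

Context (K : fieldType) (D : lmodType K).
Context (prec_perp succ_perp : D -> D -> D).
Context (prec_vdash prec_dashv succ_vdash succ_dashv : D -> D -> D).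

Local Notation "x ≺⊥ y" := (prec_perp x y) (at level 40, no associativity).
Local Notation "x ≻⊥ y" := (succ_perp x y) (at level 40, no associativity).
Local Notation "x ≺⊢ y" := (prec_vdash x y) (at level 40, no associativity).
Local Notation "x ≺⊣ y" := (prec_dashv x y) (at level 40, no associativity).
Local Notation "x ≻⊢ y" := (succ_vdash x y) (at level 40, no associativity).
Local Notation "x ≻⊣ y" := (succ_dashv x y) (at level 40, no associativity).

Record is_six_dendriform : Prop := IsSixDendriform {
  six_dendriform : is_dendriform prec_perp succ_perp;
  six_quadri_dendriform :
    is_quadri_dendriform prec_vdash prec_dashv succ_vdash succ_dashv;

  sixA1 : forall x y z, (x ≺⊢ y) ≺⊥ z = x ≺⊢ (y ≺⊥ z + y ≻⊥ z);
  sixA2 : forall x y z, (x ≻⊢ y) ≺⊥ z = x ≻⊢ (y ≺⊥ z);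
  sixA3 : forall x y z, x ≻⊢ (y ≻⊥ z) = (x ≺⊢ y + x ≻⊢ y) ≻⊥ z;
  sixA4 : forall x y z, (x ≺⊣ y) ≺⊥ z = x ≺⊥ (y ≺⊢ z + y ≻⊢ z);
  sixA5 : forall x y z, (x ≻⊣ y) ≺⊥ z = x ≻⊥ (y ≺⊢ z);
  sixA6 : forall x y z, x ≻⊥ (y ≻⊢ z) = (x ≺⊣ y + x ≻⊣ y) ≻⊥ z;
  sixA7 : forall x y z, (x ≺⊥ y) ≺⊣ z = x ≺⊥ (y ≺⊣ z + y ≻⊣ z);
  sixA8 : forall x y z, (x ≻⊥ y) ≺⊣ z = x ≻⊥ (y ≺⊣ z);
  sixA9 : forall x y z, x ≻⊥ (y ≻⊣ z) = (x ≺⊥ y + x ≻⊥ y) ≻⊣ z;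

  sixB1 : forall x y z,
    (x ≺⊥ y) ≺⊢ z = (x ≺⊢ y) ≺⊢ z /\ (x ≺⊢ y) ≺⊢ z = (x ≺⊣ y) ≺⊢ z;
  sixB2 : forall x y z,
    (x ≻⊥ y) ≺⊢ z = (x ≻⊢ y) ≺⊢ z /\ (x ≻⊢ y) ≺⊢ z = (x ≻⊣ y) ≺⊢ z;
  sixB3 : forall x y z,
    (x ≺⊥ y) ≻⊢ z = (x ≺⊢ y) ≻⊢ z /\ (x ≺⊢ y) ≻⊢ z = (x ≺⊣ y) ≻⊢ z;
  sixB4 : forall x y z,
    (x ≻⊥ y) ≻⊢ z = (x ≻⊢ y) ≻⊢ z /\ (x ≻⊢ y) ≻⊢ z = (x ≻⊣ y) ≻⊢ z;

  sixC1 : forall x y z,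
    x ≺⊣ (y ≺⊥ z) = x ≺⊣ (y ≺⊢ z) /\ x ≺⊣ (y ≺⊢ z) = x ≺⊣ (y ≺⊣ z);
  sixC2 : forall x y z,
    x ≻⊣ (y ≺⊥ z) = x ≻⊣ (y ≺⊢ z) /\ x ≻⊣ (y ≺⊢ z) = x ≻⊣ (y ≺⊣ z);
  sixC3 : forall x y z,
    x ≺⊣ (y ≻⊥ z) = x ≺⊣ (y ≻⊢ z) /\ x ≺⊣ (y ≻⊢ z) = x ≺⊣ (y ≻⊣ z);
  sixC4 : forall x y z,
    x ≻⊣ (y ≻⊥ z) = x ≻⊣ (y ≻⊢ z) /\ x ≻⊣ (y ≻⊢ z) = x ≻⊣ (y ≻⊣ z)
}.

End SixDendriform.

(* Main.v *)
Require Import Defs.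
From mathcomp Require Import all_boot all_order all_algebra.

Import GRing.Theory.
Local Open Scope ring_scope.

(** For a relative averaging operator T, both T (Tu ≺l v) and T (u ≺r Tv) equal
    the product Tu ≺ Tv of D, and similarly for ≻; when T is moreover a
    homomorphism, T (u ≺' v) and T (u ≻' v) are these same products.  In other
    words, T forgets which of the variants of ≺ (or of ≻) was used under it.

    In an axiom for the induced operations, T is applied to an inner product
    exactly when that product stands on the left of an outer ⊢ or on the right
    of an outer ⊣.  Equalities that only vary the decoration at such a place
    are therefore immediate.  In the others, pushing T inside turns the inner
    product into a product of D, and what is left is an axiom of the
    representation (if only ⊢ and ⊣ occur) or of the action (if they are mixed
    with ⊥), at arguments of D in the image of T.  The first case needs no
    product on the source of T, which is why it is the separate lemma
    [averaging_quadri_dendriform]. *)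

Lemma is_bilinear_compl (K : fieldType) (U U' V W : lmodType K)
    (f : U -> V -> W) (T : U' -> U) :
  is_bilinear f -> linear T -> is_bilinear (fun u v => f (T u) v).
Proof.
by move=> [fl fr] linT; split=> [v a u1 u2|u]; [rewrite linT fl | exact: fr].
Qed.

Lemma is_bilinear_compr (K : fieldType) (U V V' W : lmodType K)
    (f : U -> V -> W) (T : V' -> V) :
  is_bilinear f -> linear T -> is_bilinear (fun u v => f u (T v)).
Proof.
by move=> [fl fr] linT; split=> [v|u a v1 v2]; [exact: fl | rewrite linT fr].
Qed.

(** Under T, the decorations ⊢ and ⊣ become indistinguishable; this is what
    collapses the long chains of equalities among the quadri-dendriform axioms
    to the nine axioms of a representation. *)
Lemma averaging_quadri_dendriform (K : fieldType) (D V : lmodType K)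
    (prec succ : D -> D -> D)
    (precl succl : D -> V -> V) (precr succr : V -> D -> V) (T : V -> D) :
  is_representation prec succ precl succl precr succr ->
  is_relative_averaging_operator prec succ precl succl precr succr T ->
  is_quadri_dendriform
    (fun u v => precl (T u) v) (fun u v => precr u (T v))
    (fun u v => succl (T u) v) (fun u v => succr u (T v)).
Proof.
case=> bpl bsl bpr bsr ll1 ll2 ll3 lr1 lr2 lr3 rr1 rr2 rr3.
case=> linT Tpl Tpr Tsl Tsr.
have TD u v : T (u + v) = T u + T v by have := linT 1 u v; rewrite !scale1r.
pose Tin := (TD, =^~ Tpl, =^~ Tpr, =^~ Tsl, =^~ Tsr).
split; try by [apply: is_bilinear_compl | apply: is_bilinear_compr].
- by move=> x y z; rewrite !Tin ll1.
- by move=> x y z; rewrite !Tin ll2.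
- by move=> x y z; rewrite !Tin ll3.
- by move=> x y z; rewrite lr1.
- by move=> x y z; rewrite lr2.
- by move=> x y z; rewrite lr3.
- by move=> x y z; rewrite !Tin rr1.
- by move=> x y z; rewrite !Tin rr2.
- by move=> x y z; rewrite !Tin rr3.
Qed.

Theorem theorem3p10 (K : fieldType) (charK0 : [pchar K] =i pred0)
    (D D' : lmodType K)
    (prec succ : D -> D -> D) (hD : is_dendriform prec succ)
    (prec' succ' : D' -> D' -> D') (hD' : is_dendriform prec' succ')
    (precl succl : D -> D' -> D') (precr succr : D' -> D -> D')
    (hact : is_action prec succ prec' succ' precl succl precr succr)
    (T : D' -> D)
    (hT : is_homomorphic_relative_averaging_operator
            prec succ prec' succ' precl succl precr succr T) :
  is_six_dendriform
    (fun u v => prec' u v)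
    (fun u v => succ' u v)
    (fun u v => precl (T u) v)
    (fun u v => precr u (T v))
    (fun u v => succl (T u) v)
    (fun u v => succr u (T v)).
Proof.
case: hact => hrep l1 l2 l3 m1 m2 m3 r1 r2 r3.
case: hT => hav [_ Tp Ts].
have hquad : is_quadri_dendriform
    (fun u v => precl (T u) v) (fun u v => precr u (T v))
    (fun u v => succl (T u) v) (fun u v => succr u (T v)).
  exact: averaging_quadri_dendriform hrep hav.
case: hav => _ Tpl Tpr Tsl Tsr.
pose Tin := (Tp, Ts, =^~ Tpl, =^~ Tpr, =^~ Tsl, =^~ Tsr).
by split=> // x y z; rewrite !Tin.
Qed.
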